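(* Let $p^0,n^0,\rho^f\in\mathcal{C}$ be real grid functions with $\langle p^0-n^0+\rho^f,1\rangle_h=0$, let $\epsilon>0$ and $\tau>0$. Let $(p^k,n^k,\phi^k)_{k\ge 0}$ be the solution of the ETD2 scheme with time step $\tau$. If $p^0\ge 0$ and $n^0\ge 0$ (entrywise), then for every $k\ge1$, $$\widehat{E}^{k+1}\le\widehat{E}^{k},$$ where, for $k\ge 1$, $$\widehat{E}^{k}=\frac12\left(\langle p^k\ln p^k,1\rangle_h+\langle n^k\ln n^k,1\rangle_h+\langle p^{k-1}\ln p^{k-1},1\rangle_h+\langle n^{k-1}\ln n^{k-1},1\rangle_h\right)+\frac{\epsilon^2}{2}\langle\nabla_h\phi^k,\nabla_h\phi^{k-1}\rangle_h.$$
   Context: Let $L>0$, $N\in\mathbb{Z}^+$, $h=L/N$. $\mathcal{C}$ denotes the space of real grid functions $u=(u_{i,j})_{i,j\in\mathbb{Z}}$ that are $N$-periodic in each index (an $N^2$-dimensional space). The discrete inner product is $\langle u,v\rangle_h=h^2\sum_{i,j=1}^N u_{i,j}v_{i,j}$, and $1$ denotes the constant grid function. Products and logarithms of grid functions are entrywise, with the convention $0\ln 0=0$. Further, $$\langle\nabla_h u,\nabla_h v\rangle_h=h^2\sum_{i,j=1}^N\left(\frac{u_{i,j}-u_{i-1,j}}{h}\cdot\frac{v_{i,j}-v_{i-1,j}}{h}+\frac{u_{i,j}-u_{i,j-1}}{h}\cdot\frac{v_{i,j}-v_{i,j-1}}{h}\right).$$ The discrete Laplacian is $(\Delta_h u)_{i,j}=\frac1{h^2}(u_{i+1,j}+u_{i-1,j}+u_{i,j+1}+u_{i,j-1}-4u_{i,j})$.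 For $f\in\mathcal{C}$ with $\langle f,1\rangle_h=0$, $(-\epsilon^2\Delta_h)^{-1}f$ denotes the unique $\phi\in\mathcal{C}$ with $-\epsilon^2\Delta_h\phi=f$ and $\langle\phi,1\rangle_h=0$. For $\phi\in\mathcal{C}$, the linear operator $\mathcal{L}_h[\phi]:\mathcal{C}\to\mathcal{C}$ is $$(\mathcal{L}_h[\phi]u)_{i,j}=\frac1{h^2}\sum_{(i',j')}\frac{2e^{\phi_{i',j'}}e^{\phi_{i,j}}}{e^{\phi_{i',j'}}+e^{\phi_{i,j}}}\left(\frac{u_{i',j'}}{e^{\phi_{i',j'}}}-\frac{u_{i,j}}{e^{\phi_{i,j}}}\right),$$ the sum being over the four neighbours $(i',j')\in\{(i+1,j),(i-1,j),(i,j+1),(i,j-1)\}$. It discretizes $\nabla\cdot(e^{\phi}\nabla(u/e^{\phi}))$. ETD2 scheme (second-order exponential time differencing scheme for the Poisson–Nernst–Planck equations): given $p^0,n^0$, set $\phi^0=(-\epsilon^2\Delta_h)^{-1}(p^0-n^0+\rho^f)$. The first step is $$p^{1}=e^{\tau\mathcal{L}_h[-\phi^0]}p^0,\qquad n^{1}=e^{\tau\mathcal{L}_h[\phi^0]}n^0,\qquad \phi^{1}=(-\epsilon^2\Delta_h)^{-1}(p^{1}-n^{1}+\rho^f),$$ and for $k\ge1$ $$p^{k+1}=e^{2\tau\mathcal{L}_h[-\phi^k]}p^{k-1},\qquad n^{k+1}=e^{2\tau\mathcal{L}_h[\phi^k]}n^{k-1},\qquad \phi^{k+1}=(-\epsilon^2\Delta_h)^{-1}(p^{k+1}-n^{k+1}+\rho^f),$$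 where $e^{(\cdot)}$ of an operator is the operator exponential. The scheme is well defined because $p^k-n^k+\rho^f$ has zero mean for every $k$, and $p^k,n^k\ge0$ for all $k$ when $p^0,n^0\ge 0$. *)

(* Defs.v *)
From mathcomp Require Import all_boot all_order all_algebra.
From mathcomp Require Import all_classical all_reals all_analysis.

Set Implicit Arguments.
Unset Strict Implicit.
Unset Printing Implicit Defensive.

Import Order.TTheory GRing.Theory Num.Theory.
Import numFieldNormedType.Exports.

Local Open Scope ring_scope.

(* The N^2-dimensional space C of periodic grid functions is the set of
   [u : grid R] such that [grid_periodic N u]. *)
Definition grid (R : realType) : Type := int -> int -> R.

Definition grid_periodic (R : realType) (N : nat) (u : grid R) : Prop :=
  forall i j : int, u (i + N%:Z) j = u i j /\ u i (j + N%:Z) = u i j.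

Definition grid_one (R : realType) : grid R := fun _ _ => 1.

Definition inner_h (R : realType) (N : nat) (h : R) (u v : grid R) : R :=
  h ^+ 2 * \sum_(1 <= i < N.+1) \sum_(1 <= j < N.+1)
             u i%:Z j%:Z * v i%:Z j%:Z.

Definition grad_inner_h (R : realType) (N : nat) (h : R) (u v : grid R) : R :=
  h ^+ 2 * \sum_(1 <= i < N.+1) \sum_(1 <= j < N.+1)
    ((u i%:Z j%:Z - u (i%:Z - 1) j%:Z) / h
       * ((v i%:Z j%:Z - v (i%:Z - 1) j%:Z) / h)
     + (u i%:Z j%:Z - u i%:Z (j%:Z - 1)) / h
       * ((v i%:Z j%:Z - v i%:Z (j%:Z - 1)) / h)).

Definition laplacian_h (R : realType) (h : R) (u : grid R) : grid R :=
  fun i j => (h ^+ 2)^-1 *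
    (u (i + 1) j + u (i - 1) j + u i (j + 1) + u i (j - 1) - 4%:R * u i j).

(* phi = (- eps^2 Delta_h)^-1 f, for f in C of zero mean. *)
Definition is_poisson_inv (R : realType) (N : nat) (h eps : R)
    (f phi : grid R) : Prop :=
  [/\ grid_periodic N phi,
      (fun i j => - eps ^+ 2 * laplacian_h h phi i j) = f
    & inner_h N h phi (grid_one R) = 0].

Definition neighbours (i j : int) : seq (int * int) :=
  [:: (i + 1, j); (i - 1, j); (i, j + 1); (i, j - 1)].

Definition L_h (R : realType) (h : R) (phi u : grid R) : grid R :=
  fun i j => (h ^+ 2)^-1 * \sum_(q <- neighbours i j)
    (2%:R * expR (phi q.1 q.2) * expR (phi i j)
       / (expR (phi q.1 q.2) + expR (phi i j))
     * (u q.1 q.2 / expR (phi q.1 q.2) - u i j / expR (phi i j))).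

Definition grid_scale (R : realType) (c : R) (A : grid R -> grid R)
    (u : grid R) : grid R := fun i j => c * A u i j.

Definition grid_opp (R : realType) (u : grid R) : grid R := fun i j => - u i j.

(* e^A u = \sum_m A^m u / m!, the series being summed entrywise; since C is
   finite-dimensional, for a linear A : C -> C this is the usual norm-convergent
   operator exponential evaluated at u. *)
Definition op_exp (R : realType) (A : grid R -> grid R) (u : grid R) : grid R :=
  fun i j => limn (series (fun m : nat => (m`!%:R)^-1 * iter m A u i j)).

Definition net_charge (R : realType) (p n rhof : grid R) : grid R :=
  fun i j => p i j - n i j + rhof i j.

Record ETD2_solution (R : realType) (N : nat) (h eps tau : R)
    (rhof p0 n0 : grid R) (p n phi : nat -> grid R) : Prop := {
  ETD2_p0 : p 0%N = p0;
  ETD2_n0 : n 0%N = n0;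
  ETD2_phi : forall k : nat,
    is_poisson_inv N h eps (net_charge (p k) (n k) rhof) (phi k);
  ETD2_p1 : p 1%N = op_exp (grid_scale tau (L_h h (grid_opp (phi 0%N)))) (p 0%N);
  ETD2_n1 : n 1%N = op_exp (grid_scale tau (L_h h (phi 0%N))) (n 0%N);
  ETD2_pS : forall k : nat, (1 <= k)%N ->
    p k.+1 = op_exp (grid_scale (2%:R * tau) (L_h h (grid_opp (phi k)))) (p k.-1);
  ETD2_nS : forall k : nat, (1 <= k)%N ->
    n k.+1 = op_exp (grid_scale (2%:R * tau) (L_h h (phi k))) (n k.-1)
}.

(* The library sets [ln x = 0] for [x <= 0], hence [0 * ln 0 = 0]. *)
Definition entropy_h (R : realType) (N : nat) (h : R) (u : grid R) : R :=
  inner_h N h (fun i j => u i j * ln (u i j)) (grid_one R).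

(* Meaningful for k >= 1 only. *)
Definition modified_energy (R : realType) (N : nat) (h eps : R)
    (p n phi : nat -> grid R) (k : nat) : R :=
  2%:R^-1 * (entropy_h N h (p k) + entropy_h N h (n k)
             + entropy_h N h (p k.-1) + entropy_h N h (n k.-1))
  + eps ^+ 2 / 2%:R * grad_inner_h N h (phi k) (phi k.-1).

(* Main.v *)
Require Import Defs.
From mathcomp Require Import all_boot all_order all_algebra.
From mathcomp Require Import all_classical all_reals all_analysis.
From mathcomp Require Import ring lra.

Set Implicit Arguments.
Unset Strict Implicit.
Unset Printing Implicit Defensive.

Import Order.TTheory GRing.Theory Num.Theory.
Import numFieldNormedType.Exports.

Local Open Scope ring_scope.

(** Write [M = expR psi] and [P = exp (t * L_h psi)].  [P] is positive, conserves
    the grid sum and fixes [M]: positivity holds because each Euler step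
    [1 + t L / n] is positive for large [n], and [(1 + t L / n)^n] tends to [P].
    Hence the relative entropy [sum u (ln u - psi)] does not increase under [P].
    Since the leapfrog step from [k - 1] to [k + 1] uses the frozen potential
    [phi^k], summation by parts and the Poisson equation turn the difference of
    the modified energies into half the sum of the changes of the two relative
    entropies, with [psi = - phi^k] for [p] and [psi = phi^k] for [n]. *)

(** * Positivity of exponential series *)

Lemma ffact_le_expn (n m : nat) : (n ^_ m <= n ^ m)%N.
Proof.
elim: m => [|m IH] //; rewrite ffactnSr expnSr.
by rewrite leq_mul // leq_subr.
Qed.

(** The weights of the binomial expansion of (1 + x/n)^n stay below their limits 1/l!, so the gap
    between the two coefficient families has a sign. *)
Lemma bin_div_expn_le (R : realType) (n l : nat) : (0 < n)%N ->
  'C(n, l)%:R * n%:R ^- l <= (l`!%:R)^-1 :> R.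
Proof.
move=> n0; rewrite ler_pdivrMr ?exprn_gt0 ?ltr0n// mulrC.
rewrite ler_pdivlMr ?ltr0n ?fact_gt0// -natrX -natrM ler_nat bin_ffact.
exact: ffact_le_expn.
Qed.

(** With x = K/n, one has 1/(1 + x) = 1 - x/(1 + x) <= exp(- x/(1 + x)); invert and raise to the
    power n. The exponent on the left tends to K, so this lower bound is asymptotically sharp. *)
Lemma expR_le_euler (R : realType) (K : R) (n : nat) : 0 <= K -> (0 < n)%N ->
  expR (K / (1 + K / n%:R)) <= (1 + K / n%:R) ^+ n.
Proof.
move=> K0 n0; have n0' : 0 < n%:R :> R by rewrite ltr0n.
have x0 : 0 <= K / n%:R by rewrite divr_ge0.
have y0 : 0 < 1 + K / n%:R by lra.
have -> : K / (1 + K / n%:R) = n%:R * (K / n%:R / (1 + K / n%:R)).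
  by field; rewrite !gt_eqF//= (lt_le_trans n0')// lerDl.
rewrite expRM_natl lerXn2r ?nnegrE ?expR_ge0 ?(ltW y0)//.
rewrite -[leRHS]invrK -[leLHS]invrK lef_pV2 ?posrE ?invr_gt0 ?expR_gt0//.
rewrite -expRN; apply: le_trans (expR_ge1Dx _).
rewrite le_eqVlt; apply/orP; left; apply/eqP; field.
by rewrite !gt_eqF//= (lt_le_trans n0')// lerDl.
Qed.

Lemma cvg_expR_euler (R : realType) (K : R) : 0 <= K ->
  (expR (K / (1 + K / m.+1%:R)) @[m --> \oo] --> expR K)%classic.
Proof.
move=> K0; apply: continuous_cvg; first exact: continuous_expR.
rewrite -[X in (_ --> X)%classic]divr1; apply: cvgMl_tmp.
apply: (cvgV (f := fun m => 1 + K / m.+1%:R)); first by rewrite oner_neq0.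
rewrite -[X in (_ --> X)%classic]addr0; apply: cvgD; first exact: cvg_cst.
rewrite -[X in (_ --> X)%classic](mulr0 K); apply: cvgMl_tmp.
exact: cvg_harmonic.
Qed.

Lemma series_exp_coeff_le (R : realType) (K : R) (n : nat) : 0 <= K ->
  \sum_(l < n) (l`!%:R)^-1 * K ^+ l <= expR K.
Proof.
move=> K0; have := @nondecreasing_cvgn_le R (series (exp_coeff K)) _ _ n.
rewrite /series/= big_mkord /exp_coeff /=.
under eq_bigr do rewrite mulrC; apply; last exact: is_cvg_series_exp_coeff.
by apply: nondecreasing_series => *; exact: exp_coeff_ge0.
Qed.

Lemma cvg_series_geometric_bound (R : realType) (a : nat -> R) (C K : R) :
  0 <= K -> (forall l, `|a l| <= C * K ^+ l) ->
  cvgn (series (fun l => (l`!%:R)^-1 * a l)).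
Proof.
move=> K0 aC; apply: normed_cvg.
have C0 : 0 <= C by have := aC 0%N; rewrite expr0 mulr1; apply: le_trans.
apply: (@series_le_cvg _ _ (fun l => C * exp_coeff K l)).
- by move=> l /=.
- by move=> l; rewrite mulr_ge0// exp_coeff_ge0.
- move=> l; rewrite /= normrM ger0_norm ?invr_ge0//.
  by rewrite /exp_coeff/= mulrA mulrC ler_wpM2r ?invr_ge0.
- by apply: (@is_cvg_seriesZ _ (exp_coeff K) C); exact: is_cvg_series_exp_coeff.
Qed.

(* Tannery's argument, with the tail controlled by comparing [(1 + K/n)^n]
   with [expR K] instead of a dominated convergence theorem. *)
Lemma exp_series_ge0 (R : realType) (a : nat -> R) (C K : R) :
  0 <= K -> (forall l, `|a l| <= C * K ^+ l) ->
  (\forall n \near \oo%classic,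
     0 <= \sum_(l < n.+2) 'C(n.+1, l)%:R * n.+1%:R ^- l * a l) ->
  0 <= limn (series (fun l => (l`!%:R)^-1 * a l)).
Proof.
move=> K0 aC a0; have ca := cvg_series_geometric_bound K0 aC.
have C0 : 0 <= C by have := aC 0%N; rewrite expr0 mulr1; apply: le_trans.
set T := series _ in ca *.
(* The power n+1 expands into n+2 binomial terms, hence the partial sum of that length. *)
have cT : (T n.+2 @[n --> \oo] --> limn T)%classic.
  by move: ca; rewrite -{1}cvg_shiftS -{1}cvg_shiftS.
have <- := cvg_lim (@Rhausdorff R) cT.
(* A lower bound for the partial sums that tends to 0: [- s n] dominates the distance from [T n.+2]
   to the nonnegative binomial sum. *)
pose s n := C * (expR (K / (1 + K / n.+1%:R)) - expR K).
have cs : (s n @[n --> \oo] --> (0 : R))%classic.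
  rewrite -(mulr0 C) -(subrr (expR K)); apply: cvgMl_tmp.
  by apply: cvgB; [exact: cvg_expR_euler | exact: cvg_cst].
have <- := cvg_lim (@Rhausdorff R) cs; apply: ler_lim.
- by apply/cvg_ex; exists 0.
- by apply/cvg_ex; exists (limn T).
near=> n.
have : 0 <= \sum_(l < n.+2) 'C(n.+1, l)%:R * n.+1%:R ^- l * a l by near: n.
set E := \sum_(l < _) _ => E0.
suff : `|T n.+2 - E| <= - s n.
  by rewrite ler_norml opprK => /andP[+ _] => h; lra.
rewrite /T /series/= big_mkord /E -sumrB.
apply: (le_trans (ler_norm_sum _ _ _)).
have wl l : 0 <= (l`!%:R)^-1 - 'C(n.+1, l)%:R * n.+1%:R ^- l :> R.
  by rewrite subr_ge0 bin_div_expn_le.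
apply: (@le_trans _ _
  (\sum_(l < n.+2) ((l`!%:R)^-1 - 'C(n.+1, l)%:R * n.+1%:R ^- l) * (C * K ^+ l))).
  by apply: ler_sum => l _; rewrite -mulrBl normrM ger0_norm// ler_wpM2l.
(* As the coefficient gaps are nonnegative, their weighted sum is exactly a truncated exponential
   minus an Euler power. *)
have -> : \sum_(l < n.+2) ((l`!%:R)^-1 - 'C(n.+1, l)%:R * n.+1%:R ^- l) * (C * K ^+ l)
   = C * (\sum_(l < n.+2) (l`!%:R)^-1 * K ^+ l - (1 + K / n.+1%:R) ^+ n.+1).
  rewrite exprDn -sumrB mulr_sumr; apply: eq_bigr => l _.
  by rewrite expr1n mul1r expr_div_n -mulr_natl; ring.
rewrite /s -mulrN opprB ler_wpM2l// lerB ?series_exp_coeff_le//.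
exact: expR_le_euler.
Unshelve. all: by end_near.
Qed.

(** * Exponentials of grid operators *)

Section OperatorExponential.
Context {R : realType}.
Implicit Types (A : grid R -> grid R) (u v : grid R) (a b C K x : R).

Definition grid_linear A := forall a b u v,
  A (fun i j => a * u i j + b * v i j) = (fun i j => a * A u i j + b * A v i j).

(** Convergence is argued in the supremum norm, which keeps this section free of the period;
    periodic grid functions are shown to be bounded later. *)
Definition grid_bounded u C := forall i j, `|u i j| <= C.

Definition op_bounded K A := forall u C,
  grid_bounded u C -> grid_bounded (A u) (K * C).

Lemma grid_linear0 A : grid_linear A -> A (fun _ _ => 0) = (fun _ _ => 0).
Proof.
move=> linA; have := linA 0 0 (fun _ _ => 0) (fun _ _ => 0).
under [X in A X]eq_fun do under eq_fun do rewrite !mul0r addr0.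
by move=> ->; apply/funext => i; apply/funext => j; rewrite !mul0r addr0.
Qed.

Lemma iter_grid_linear A m : grid_linear A -> grid_linear (iter m A).
Proof. by move=> linA a b u v; elim: m => //= m ->; rewrite linA. Qed.

Lemma iter_grid_bounded A u C K m : op_bounded K A -> grid_bounded u C ->
  grid_bounded (iter m A u) (C * K ^+ m).
Proof.
move=> bA bu; elim: m => [|m IH]; first by rewrite expr0 mulr1.
by rewrite exprS mulrCA; exact: bA.
Qed.

Lemma cvg_op_exp A u C K i j : 0 <= K -> op_bounded K A -> grid_bounded u C ->
  (series (fun m => (m`!%:R)^-1 * iter m A u i j) n @[n --> \oo]
     --> op_exp A u i j)%classic.
Proof.
move=> K0 bA bu; apply: (@cvg_series_geometric_bound _ _ C K) => // l.
exact: iter_grid_bounded.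
Qed.

Lemma op_exp_linear A a b u v C C' K : 0 <= K -> grid_linear A ->
  op_bounded K A -> grid_bounded u C -> grid_bounded v C' ->
  op_exp A (fun i j => a * u i j + b * v i j)
    = (fun i j => a * op_exp A u i j + b * op_exp A v i j).
Proof.
move=> K0 linA bA bu bv; apply/funext => i; apply/funext => j.
apply: (cvg_lim (@Rhausdorff R)).
pose S w n := series (fun m => (m`!%:R)^-1 * iter m A w i j) n.
rewrite -[X in (X @ _ --> _)%classic]/(S _).
rewrite (_ : S _ = fun n => a * S u n + b * S v n).
  by apply: cvgD; apply: cvgMl_tmp; [exact: (cvg_op_exp (i := i) (j := j) K0 bA bu) 
    | exact: (cvg_op_exp (i := i) (j := j) K0 bA bv)].
apply/funext => n; rewrite /S /series/= !mulr_sumr -big_split/=.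
by apply: eq_bigr => l _; rewrite iter_grid_linear//; ring.
Qed.

Lemma op_exp_ker A u : grid_linear A -> A u = (fun _ _ => 0) -> op_exp A u = u.
Proof.
move=> linA Au; apply/funext => i; apply/funext => j.
apply: (cvg_lim (@Rhausdorff R)); rewrite -cvg_shiftS /=.
apply: cvg_near_cst; apply: nearW => n.
rewrite /series/= big_nat_recl//= fact0 invr1 mul1r big1 ?addr0// => l _.
have -> : A (iter l A u) = fun _ _ => 0; last by rewrite mulr0.
by elim: l => //= l ->; rewrite grid_linear0.
Qed.

(** The binomial theorem for (1 + x A)^n, by Pascal's rule. *)
Lemma iter_euler_step A x u n : grid_linear A ->
  iter n (fun v i j => v i j + x * A v i j) u
    = (fun i j => \sum_(l < n.+1) 'C(n, l)%:R * x ^+ l * iter l A u i j).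
Proof.
move=> linA; elim: n u => [|n IH] u.
  by apply/funext => i; apply/funext => j; rewrite big_ord1 !mul1r.
rewrite iterSr IH; apply/funext => i; apply/funext => j.
have eqi l : iter l A (fun i j => u i j + x * A u i j) i j
    = iter l A u i j + x * iter l.+1 A u i j.
  have := @iter_grid_linear A l linA 1 x u (A u).
  under [X in iter l A X]eq_fun do under eq_fun do rewrite mul1r.
  by move=> ->; rewrite mul1r iterSr.
under eq_bigr do rewrite eqi mulrDr.
rewrite big_split/= [RHS]big_ord_recl/= bin0.
under [X in _ = _ + X]eq_bigr do rewrite /bump/= add1n binS natrD !mulrDl.
rewrite [X in _ = _ + X]big_split/= addrA; congr (_ + _).
  rewrite big_ord_recl/= bin0 [X in _ = _ + X]big_ord_recr/=.
  rewrite bin_small// !mul0r addr0; congr (_ + _).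
by apply: eq_bigr => l _; rewrite exprS; ring.
Qed.

Lemma op_exp_ge0 A u C K x0 : 0 <= K -> grid_linear A -> op_bounded K A ->
  0 < x0 ->
  (forall x v, 0 <= x <= x0 -> (forall i j, 0 <= v i j) ->
     forall i j, 0 <= v i j + x * A v i j) ->
  grid_bounded u C -> (forall i j, 0 <= u i j) ->
  forall i j, 0 <= op_exp A u i j.
Proof.
move=> K0 linA bA x00 posA bu u0 i j.
apply: (@exp_series_ge0 _ _ C K) => // [l|]; first exact: iter_grid_bounded.
near=> n.
have x_x0 : 0 <= (n.+1%:R^-1 : R) <= x0.
  rewrite invr_ge0 ler0n /= ltW//; near: n.
  exact: (cvgr_lt (0 : R) (@cvg_harmonic R)).
under eq_bigr do rewrite -exprVn.
have := iter_euler_step (n.+1%:R^-1) u n.+1 linA.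
move=> /(congr1 (fun f => f i j)) <-.
(* Only the number of iterations is generalised; the step size 1/(n+1) stays fixed. *)
elim: {1}n.+1 i j => //= m IH; exact: posA.
Unshelve. all: by end_near.
Qed.

End OperatorExponential.

(** * Periodic grids and summation by parts *)

Section PeriodicGrids.
Context {R : realType} (N : nat).
Implicit Types (u v w : grid R) (a b h : R).

Definition grid_sum u : R :=
  \sum_(1 <= i < N.+1) \sum_(1 <= j < N.+1) u i%:Z j%:Z.

Lemma inner_hE h u v : inner_h N h u v = h ^+ 2 * grid_sum (fun i j => u i j * v i j).
Proof. by []. Qed.

Lemma eq_grid_sum u v : (forall i j, u i j = v i j) -> grid_sum u = grid_sum v.
Proof.
by move=> uv; apply: eq_bigr => i _; apply: eq_bigr => j _; exact: uv.
Qed.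

Lemma ler_grid_sum u v : (forall i j, u i j <= v i j) -> grid_sum u <= grid_sum v.
Proof.
by move=> uv; apply: ler_sum => i _; apply: ler_sum => j _; exact: uv.
Qed.

Lemma grid_sum_linear a b u v :
  grid_sum (fun i j => a * u i j + b * v i j) = a * grid_sum u + b * grid_sum v.
Proof.
rewrite /grid_sum !mulr_sumr -big_split/=; apply: eq_bigr => i _.
by rewrite !mulr_sumr -big_split.
Qed.

Lemma periodic_modz (T : Type) (f : int -> T) :
  (forall i, f (i + N%:Z) = f i) -> forall i, f i = f (i %% N%:Z)%Z.
Proof.
move=> pf i; rewrite [in LHS](divz_eq i N%:Z) addrC.
elim: (i %/ N%:Z)%Z => [|n IH|n IH]; first by rewrite mul0r addr0.
- by rewrite -IH -(pf (_ + n%:Z * _)); congr f; ring.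
- by rewrite -IH -(pf (_ + - n.+1%:Z * _)); congr f; rewrite -addn1 PoszD; ring.
Qed.

Lemma sum_periodic_diff (f : int -> R) : (forall i, f (i + N%:Z) = f i) ->
  \sum_(1 <= i < N.+1) (f i%:Z - f (i%:Z - 1)) = 0.
Proof.
move=> pf; rewrite big_add1/=.
rewrite (eq_bigr (fun i : nat => f i.+1%:Z - f i%:Z)).
  by rewrite (telescope_sumr (fun i : nat => f i%:Z))// -[N%:Z]add0r pf subrr.
by move=> i _; congr (_ - f _); rewrite -addn1 PoszD addrK.
Qed.

(** The sum of a discrete divergence telescopes to 0 in each direction. Both summation by parts and
    the conservation of mass by [L_h] reduce to this. *)
Lemma grid_sum_diff u v : grid_periodic N u -> grid_periodic N v ->
  grid_sum (fun i j => u i j - u (i - 1) j + (v i j - v i (j - 1))) = 0.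
Proof.
move=> pu pv; have -> : grid_sum (fun i j => u i j - u (i - 1) j + (v i j - v i (j - 1)))
    = 1 * grid_sum (fun i j => u i j - u (i - 1) j)
    + 1 * grid_sum (fun i j => v i j - v i (j - 1)).
  by rewrite -grid_sum_linear; apply: eq_grid_sum => i j; rewrite !mul1r.
rewrite /grid_sum [X in 1 * X]exchange_big/= !big1 ?mulr0 ?addr0// => i _.
  by rewrite (sum_periodic_diff (f := fun j => v i%:Z j))// => j; have [] := pv i j.
by rewrite (sum_periodic_diff (f := fun j => u j i%:Z))// => j; have [] := pu j i%:Z.
Qed.

Lemma grad_inner_h_by_parts h u v : grid_periodic N u -> grid_periodic N v ->
  grad_inner_h N h u v = - inner_h N h u (laplacian_h h v).
Proof.
move=> pu pv; apply/eqP; rewrite -subr_eq0 opprK; apply/eqP.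
(* By the discrete product rule, the backward divergence of (F, G) is the gradient product plus u
   times the Laplacian of v. *)
pose F : grid R := fun i j => (h ^+ 2)^-1 * (u i j * (v (i + 1) j - v i j)).
pose G : grid R := fun i j => (h ^+ 2)^-1 * (u i j * (v i (j + 1) - v i j)).
have pF : grid_periodic N F.
  move=> i j; have [ui uj] := pu i j; have [vi vj] := pv i j.
  have [vi' _] := pv (i + 1) j; have [_ vj'] := pv (i + 1) j.
  by rewrite /F ui uj vi vj vj' addrAC vi'.
have pG : grid_periodic N G.
  move=> i j; have [ui uj] := pu i j; have [vi vj] := pv i j.
  have [vi' _] := pv i (j + 1); have [_ vj'] := pv i (j + 1).
  by rewrite /G ui uj vi vj vi' addrAC vj'.
rewrite -[RHS](mulr0 (h ^+ 2)) -[X in _ = _ * X](grid_sum_diff pF pG).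
rewrite /grad_inner_h /inner_h -mulrDr; congr (_ * _).
rewrite -big_split; apply: eq_bigr => i _.
rewrite -big_split; apply: eq_bigr => j _ /=.
rewrite /F /G /laplacian_h !subrK expr2 invfM; ring.
Qed.

Lemma grid_periodic_bounded u : (0 < N)%N -> grid_periodic N u ->
  exists C, grid_bounded u C.
Proof.
(* The sum of absolute values over one period dominates each of its terms, and reduction modulo N
   identifies every grid value with one of them. *)
move=> N0 pu; exists (\sum_(i < N) \sum_(j < N) `|u i%:Z j%:Z|) => i j.
have N0' : N%:Z != 0 by rewrite eqz_nat -lt0n.
rewrite (periodic_modz (f := fun i => u i j)); last by move=> k; have [] := pu k j.
set i' := (i %% N%:Z)%Z.
rewrite (periodic_modz (f := fun j => u i' j)); last by move=> k; have [] := pu i' k.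
have modP (k : int) : exists k' : 'I_N, (k %% N%:Z)%Z = k'%:Z.
  have k0 := modz_ge0 k N0'.
  have kN : (`|(k %% N%:Z)%Z| < N)%N by rewrite -ltz_nat gez0_abs// ltz_pmod.
  by exists (Ordinal kN); rewrite /= gez0_abs.
have [a ->] := modP j; have [b ib] := modP i; rewrite {}/i' ib.
rewrite (bigD1 b)//= (bigD1 a)//= -addrA lerDl addr_ge0// !sumr_ge0// => c _.
by rewrite sumr_ge0.
Qed.

End PeriodicGrids.

(** * The operator L_h *)

Section ExponentialFlux.
Context {R : realType}.
Implicit Types (a b x y C : R).

(** One edge of [L_h] as a function of four reals: the harmonic mean of the weights times the
    difference of the weighted densities. *)
Definition exp_flux a b x y : R := 2%:R * a * b / (a + b) * (x / a - y / b).

Lemma exp_flux_antisym a b x y : exp_flux b a y x = - exp_flux a b x y.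
Proof. by rewrite /exp_flux (addrC b); ring. Qed.

Lemma exp_flux_linear a b s t x y x' y' :
  exp_flux a b (s * x + t * x') (s * y + t * y')
    = s * exp_flux a b x y + t * exp_flux a b x' y'.
Proof. by rewrite /exp_flux; ring. Qed.

(** In this form the coefficients 2b/(a+b) of x and -2a/(a+b) of y are visibly at most 2 in absolute
    value, whatever the weights; so the bounds on [L_h] do not depend on [psi]. *)
Lemma exp_fluxE a b x y : 0 < a -> 0 < b ->
  exp_flux a b x y = 2%:R * (b * x - a * y) / (a + b).
Proof.
by move=> a0 b0; rewrite /exp_flux; field; rewrite !gt_eqF// addr_gt0.
Qed.

Lemma exp_flux_stationary a b : 0 < a -> 0 < b -> exp_flux a b a b = 0.
Proof. by move=> a0 b0; rewrite exp_fluxE// (mulrC b) subrr mulr0 mul0r. Qed.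

Lemma exp_flux_bound a b x y C : 0 < a -> 0 < b -> `|x| <= C -> `|y| <= C ->
  `|exp_flux a b x y| <= 2%:R * C.
Proof.
move=> a0 b0 xC yC; have ab0 : 0 < a + b by rewrite addr_gt0.
rewrite exp_fluxE// normrM [`|_^-1|]gtr0_norm ?invr_gt0// ler_pdivrMr//.
rewrite normrM ger0_norm// -mulrA ler_wpM2l// (le_trans (ler_normB _ _))//.
rewrite !normrM (gtr0_norm a0) (gtr0_norm b0) mulrDr addrC [C * a]mulrC [C * b]mulrC.
by apply: lerD; rewrite ler_wpM2l// ltW.
Qed.

Lemma exp_flux_ge a b x y : 0 < a -> 0 < b -> 0 <= x -> 0 <= y ->
  - (2%:R * y) <= exp_flux a b x y.
Proof.
move=> a0 b0 x0 y0; rewrite exp_fluxE// ler_pdivlMr ?addr_gt0//; nra.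
Qed.

End ExponentialFlux.

Section DriftDiffusion.
Context {R : realType} (h : R) (psi : grid R).
Implicit Types (u v : grid R).

Definition edge_flux u (q q' : int * int) : R :=
  exp_flux (expR (psi q.1 q.2)) (expR (psi q'.1 q'.2)) (u q.1 q.2) (u q'.1 q'.2).

Lemma L_hE u i j : L_h h psi u i j = (h ^+ 2)^-1 *
  (edge_flux u (i + 1, j) (i, j) + edge_flux u (i - 1, j) (i, j)
   + edge_flux u (i, j + 1) (i, j) + edge_flux u (i, j - 1) (i, j)).
Proof. by rewrite /L_h !big_cons big_nil addr0 !addrA. Qed.

Lemma L_h_linear : grid_linear (L_h h psi).
Proof.
move=> a b u v; apply/funext => i; apply/funext => j.
by rewrite !L_hE /edge_flux !exp_flux_linear; ring.
Qed.

Lemma L_h_bounded : op_bounded (8%:R / h ^+ 2) (L_h h psi).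
Proof.
move=> u C uC i j; rewrite L_hE normrM ger0_norm ?invr_ge0 ?sqr_ge0//.
rewrite mulrAC mulrC ler_wpM2r ?invr_ge0 ?sqr_ge0//.
have fC q q' : `|edge_flux u q q'| <= 2%:R * C.
  by apply: exp_flux_bound; rewrite ?expR_gt0.
have -> : 8%:R * C = 2%:R * C + 2%:R * C + 2%:R * C + 2%:R * C by ring.
by rewrite !(le_trans (ler_normD _ _) (lerD _ _)).
Qed.

(** The neighbours contribute with nonnegative coefficients, and each of the four edges takes away
    at most twice the value at the node. This makes small Euler steps positive. *)
Lemma L_h_ge u i j : (forall i j, 0 <= u i j) ->
  - (8%:R / h ^+ 2 * u i j) <= L_h h psi u i j.
Proof.
move=> u0; rewrite L_hE mulrAC -mulNr mulrC ler_wpM2l ?invr_ge0 ?sqr_ge0//.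
have fC q : - (2%:R * u i j) <= edge_flux u q (i, j).
  by apply: exp_flux_ge; rewrite ?expR_gt0.
have := fC (i + 1, j); have := fC (i - 1, j).
by have := fC (i, j + 1); have := fC (i, j - 1); lra.
Qed.

(** Detailed balance: the flux vanishes on each edge separately. *)
Lemma L_h_stationary :
  L_h h psi (fun i j => expR (psi i j)) = (fun _ _ => 0).
Proof.
apply/funext => i; apply/funext => j.
by rewrite L_hE /edge_flux !exp_flux_stationary ?expR_gt0// !addr0 mulr0.
Qed.

Context (N : nat) (psi_per : grid_periodic N psi).

Lemma edge_flux_periodic u (a b : int) : grid_periodic N u ->
  grid_periodic N (fun i j => edge_flux u (i + a, j + b) (i, j)).
Proof.
move=> pu i j; rewrite /edge_flux/= ![_ + N%:Z + _]addrAC.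
have [-> ->] := pu i j; have [-> ->] := pu (i + a) (j + b).
by have [-> ->] := psi_per i j; have [-> ->] := psi_per (i + a) (j + b).
Qed.

Lemma L_h_periodic u : grid_periodic N u -> grid_periodic N (L_h h psi u).
Proof.
move=> pu i j; rewrite !L_hE.
have [x1 x2] := edge_flux_periodic 1 0 pu i j.
have [x3 x4] := edge_flux_periodic (-1) 0 pu i j.
have [y1 y2] := edge_flux_periodic 0 1 pu i j.
have [y3 y4] := edge_flux_periodic 0 (-1) pu i j.
by rewrite !addr0 in x1 x2 x3 x4 y1 y2 y3 y4; rewrite x1 x2 x3 x4 y1 y2 y3 y4.
Qed.

Lemma grid_sum_L_h u : grid_periodic N u -> grid_sum N (L_h h psi u) = 0.
Proof.
move=> pu; pose c := (h ^+ 2)^-1.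
rewrite -[RHS](mulr0 c) -(grid_sum_diff (edge_flux_periodic 1 0 pu)
  (edge_flux_periodic 0 1 pu)).
(* Terms with coefficient 0 are added so that the two-term rule [grid_sum_linear] can move the
   factor [c] inside the sum. *)
rewrite -[LHS]addr0 -[X in _ + X](mul0r (grid_sum N u)).
rewrite -[in LHS](mul1r (grid_sum N (L_h _ _ _))) -grid_sum_linear.
rewrite -[RHS]addr0 -[X in _ = _ + X](mul0r (grid_sum N u)) -grid_sum_linear.
apply: eq_grid_sum => i j; rewrite !mul0r !addr0 mul1r L_hE !subrK /edge_flux /c /=.
(* Antisymmetry turns the fluxes from the left and lower neighbours into shifted forward fluxes, so
   [L_h] is a divergence. *)
rewrite (exp_flux_antisym (expR (psi i j)) (expR (psi (i - 1) j))).
by rewrite (exp_flux_antisym (expR (psi i j)) (expR (psi i (j - 1)))); ring.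
Qed.

End DriftDiffusion.

(** * Entropy decay *)

Lemma grid_periodic_map2 (R : realType) (N : nat) (f : R -> R -> R) (u v : grid R) :
  grid_periodic N u -> grid_periodic N v ->
  grid_periodic N (fun i j => f (u i j) (v i j)).
Proof.
by move=> pu pv i j; have [-> ->] := pu i j; have [-> ->] := pv i j.
Qed.

(** The left side is the tangent at b of the convex function x ln x. For x > 0 the bound is ln(b/x)
    <= b/x - 1 multiplied by x. *)
Lemma xlnx_ge (R : realType) (x b : R) : 0 <= x -> 0 < b ->
  (1 + ln b) * x - b <= x * ln x.
Proof.
rewrite le_eqVlt => /predU1P[<- b0|x0 b0]; first by rewrite mulr0 mul0r; lra.
have : ln (1 + (b / x - 1)) <= b / x - 1.
  by apply: le_ln1Dx; rewrite ltrBrDr addNr divr_gt0.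
rewrite addrC subrK ln_div ?posrE// -(ler_pM2l x0) !mulrBr mulrCA divff ?gt_eqF//.
by lra.
Qed.

(** * The semigroup generated by [L_h]: positivity, conservation and relative entropy *)

Section DriftDiffusionSemigroup.
Context {R : realType} (h t : R) (psi : grid R) (N : nat).
Context (h_gt0 : 0 < h) (t_gt0 : 0 < t) (N_gt0 : (0 < N)%N)
  (psi_per : grid_periodic N psi).
Implicit Types (u v : grid R).

Let A := grid_scale t (L_h h psi).

Lemma scaled_L_h_linear : grid_linear A.
Proof.
move=> a b u v; rewrite /A /grid_scale L_h_linear.
by apply/funext => i; apply/funext => j; ring.
Qed.

Lemma scaled_L_h_bounded : op_bounded (t * (8%:R / h ^+ 2)) A.
Proof.
move=> u C uC i j; rewrite /A /grid_scale normrM gtr0_norm// -mulrA.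
by rewrite ler_pM2l//; exact: L_h_bounded.
Qed.

Let K_ge0 : 0 <= t * (8%:R / h ^+ 2).
Proof. by rewrite mulr_ge0 ?divr_ge0 ?sqr_ge0// ltW. Qed.

(** Up to this threshold the coefficient 1 - 8 t x / h^2 left at the node by [L_h_ge] is
    nonnegative. *)
Lemma scaled_L_h_euler_ge0 x u : 0 <= x <= (t * (8%:R / h ^+ 2))^-1 ->
  (forall i j, 0 <= u i j) -> forall i j, 0 <= u i j + x * A u i j.
Proof.
move=> /andP[x0]; have K0 : 0 < t * (8%:R / h ^+ 2).
  by rewrite mulr_gt0// divr_gt0// exprn_gt0.
rewrite -[_^-1]div1r ler_pdivlMr// => xK u0 i j.
have := L_h_ge h psi i j u0; rewrite /A /grid_scale => Lu.
have := ler_wpM2l (mulr_ge0 x0 (ltW t_gt0)) Lu.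
have := ler_wpM2r (u0 i j) xK.
by lra.
Qed.

Lemma iter_scaled_L_h_periodic u m : grid_periodic N u ->
  grid_periodic N (iter m A u).
Proof.
move=> pu; elim: m => //= m IH i j; rewrite /A /grid_scale.
by have [-> ->] := L_h_periodic h psi_per IH i j.
Qed.

Lemma op_exp_L_h_periodic u : grid_periodic N u -> grid_periodic N (op_exp A u).
Proof.
move=> pu i j; rewrite /op_exp; split; congr (limn (series _));
  apply/funext => m; have [pi pj] := iter_scaled_L_h_periodic m pu i j;
  by rewrite (pi, pj).
Qed.

Lemma op_exp_L_h_ge0 u : grid_periodic N u -> (forall i j, 0 <= u i j) ->
  forall i j, 0 <= op_exp A u i j.
Proof.
move=> pu u0; have [C uC] := grid_periodic_bounded N_gt0 pu.
apply: (op_exp_ge0 K_ge0 scaled_L_h_linear scaled_L_h_bounded _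
  scaled_L_h_euler_ge0 uC u0).
by rewrite invr_gt0 mulr_gt0// divr_gt0// exprn_gt0.
Qed.

Lemma op_exp_L_h_linear a b u v : grid_periodic N u -> grid_periodic N v ->
  op_exp A (fun i j => a * u i j + b * v i j)
    = (fun i j => a * op_exp A u i j + b * op_exp A v i j).
Proof.
move=> /(grid_periodic_bounded N_gt0)[C uC] /(grid_periodic_bounded N_gt0)[C' vC].
exact: (op_exp_linear _ _ K_ge0 scaled_L_h_linear scaled_L_h_bounded uC vC).
Qed.

Lemma op_exp_L_h_le u v : grid_periodic N u -> grid_periodic N v ->
  (forall i j, u i j <= v i j) -> forall i j, op_exp A u i j <= op_exp A v i j.
Proof.
move=> pu pv uv i j; have := op_exp_L_h_linear 1 (-1) pv pu.
move=> /(congr1 (fun f => f i j)); rewrite mul1r mulN1r -subr_ge0 => <-.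
apply: op_exp_L_h_ge0 => [|k l].
  exact: (grid_periodic_map2 (fun x y => 1 * x + -1 * y) pv pu).
by rewrite mul1r mulN1r subr_ge0.
Qed.

Lemma op_exp_L_h_stationary :
  op_exp A (fun i j => expR (psi i j)) = (fun i j => expR (psi i j)).
Proof.
apply: op_exp_ker; first exact: scaled_L_h_linear.
by rewrite /A /grid_scale L_h_stationary mulr0.
Qed.

(** The finite grid sum commutes with the limit, and every term of the series after the first is in
    the range of [L_h], hence has zero sum. *)
Lemma grid_sum_op_exp_L_h u : grid_periodic N u ->
  grid_sum N (op_exp A u) = grid_sum N u.
Proof.
move=> pu; have [C uC] := grid_periodic_bounded N_gt0 pu.
pose S n : grid R := fun i j => series (fun m => (m`!%:R)^-1 * iter m A u i j) n.
have cS : (grid_sum N (S n) @[n --> \oo] --> grid_sum N (op_exp A u))%classic.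
  apply: cvg_big => [|i _]; first exact: add_continuous.
  apply: cvg_big => [|j _]; first exact: add_continuous.
  exact: (cvg_op_exp (i := i) (j := j) K_ge0 scaled_L_h_bounded uC).
rewrite -(cvg_lim (@Rhausdorff R) cS); apply: (cvg_lim (@Rhausdorff R)).
(* The shift discards the empty partial sum; all later ones have the grid sum of u. *)
rewrite -cvg_shiftS; apply: cvg_near_cst; apply: nearW => /=.
elim=> [|n IH].
  apply: eq_grid_sum => i j.
  by rewrite /S /series/= big_nat1 fact0 invr1 mul1r.
have -> : grid_sum N (S n.+2)
    = 1 * grid_sum N (S n.+1) + (n.+1`!%:R^-1 * t) * grid_sum N (L_h h psi (iter n A u)).
  rewrite -grid_sum_linear; apply: eq_grid_sum => i j.
  by rewrite /S /series/= big_nat_recr//= mul1r -mulrA.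
rewrite grid_sum_L_h ?mulr0 ?addr0 ?mul1r//.
exact: iter_scaled_L_h_periodic.
Qed.

(* [exp A] is a Markov-type operator with stationary measure [expR psi], and
   [x * ln x] is the supremum over [b > 0] of the affine maps of [xlnx_ge]: the
   value [a] optimal at the image point replaces Jensen's inequality. *)
Lemma op_exp_L_h_entropy_le u : grid_periodic N u -> (forall i j, 0 <= u i j) ->
  forall i j, op_exp A u i j * ln (op_exp A u i j) - psi i j * op_exp A u i j
    <= op_exp A (fun i j => u i j * ln (u i j) - psi i j * u i j) i j.
Proof.
move=> pu u0 i j; set eta := fun i j => _ - _.
have peta : grid_periodic N eta.
  exact: (grid_periodic_map2 (fun x y => x * ln x - y * x) pu psi_per).
pose M : grid R := fun i j => expR (psi i j).
have pM : grid_periodic N M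
    by exact: (grid_periodic_map2 (fun x _ => expR x) psi_per psi_per).
(* Take the tangent of x ln x at b = a M, where ln b = ln a + psi: this gives (1 + ln a) u - a M <=
   eta at every node. The exponential preserves this order and fixes M. *)
have affine_le a : 0 < a ->
    (1 + ln a) * op_exp A u i j - a * M i j <= op_exp A eta i j.
  move=> a0; have := op_exp_L_h_linear (1 + ln a) (- a) pu pM.
  rewrite op_exp_L_h_stationary => /(congr1 (fun f => f i j)).
  rewrite [in X in _ = X]mulNr => <-; apply: op_exp_L_h_le => //.
    exact: (grid_periodic_map2 (fun x y => (1 + ln a) * x + - a * y) pu pM).
  move=> k l; have := @xlnx_ge R (u k l) (a * M k l) (u0 k l).
  rewrite mulr_gt0 ?expR_gt0// => /(_ isT).
  rewrite lnM ?posrE ?expR_gt0// expRK /eta; lra.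
have Mij : 0 < M i j by exact: expR_gt0.
have := op_exp_L_h_ge0 pu u0 i j; rewrite le_eqVlt => /predU1P[w0|w0].
  rewrite -w0 mul0r mulr0 subr0 leNgt; apply/negP => eta0.
  (* Where the image of u vanishes, [affine_le] says that - a M is a lower bound for every a > 0. If
     the image of eta were negative, this choice of a would bound it below by half of itself. *)
  have := affine_le (- op_exp A eta i j / (2%:R * M i j)).
  rewrite divr_gt0 ?mulr_gt0 ?oppr_gt0// => /(_ isT); rewrite -w0 mulr0.
  have -> : - op_exp A eta i j / (2%:R * M i j) * M i j = - op_exp A eta i j / 2%:R.
    by field; rewrite gt_eqF.
  by lra.
(* The optimal a is the ratio of the image of u to M, for which the affine bound equals the left
   side. *)
have := affine_le _ (divr_gt0 w0 Mij).
by rewrite divfK ?gt_eqF// ln_div ?posrE// expRK; lra.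
Qed.

Lemma relative_entropy_op_exp_L_h u : grid_periodic N u ->
  (forall i j, 0 <= u i j) ->
  entropy_h N h (op_exp A u) - inner_h N h psi (op_exp A u)
    <= entropy_h N h u - inner_h N h psi u.
Proof.
move=> pu u0.
have E w : entropy_h N h w - inner_h N h psi w
    = h ^+ 2 * grid_sum N (fun i j => w i j * ln (w i j) - psi i j * w i j).
  rewrite /entropy_h !inner_hE -mulrBr; congr (_ * _).
  rewrite -[X in X - _]mul1r -mulN1r -grid_sum_linear.
  by apply: eq_grid_sum => i j; rewrite /grid_one; ring.
rewrite !E ler_wpM2l ?sqr_ge0//.
(* Conservation is applied to the density u ln u - psi u, not to u; the pointwise bound can then be
   summed. *)
rewrite -[leRHS]grid_sum_op_exp_L_h.
  by apply: ler_grid_sum => i j; exact: op_exp_L_h_entropy_le.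
exact: (grid_periodic_map2 (fun x y => x * ln x - y * x) pu psi_per).
Qed.

End DriftDiffusionSemigroup.

(** * The modified energy *)

Section Energy.
Context {R : realType} (N : nat) (h eps : R).
Implicit Types (u v p n rhof phi : grid R).

Lemma grid_periodic_opp u : grid_periodic N u -> grid_periodic N (grid_opp u).
Proof. by move=> pu; exact: (grid_periodic_map2 (fun x _ => - x) pu pu). Qed.

Lemma inner_h_linear a b u v w :
  inner_h N h w (fun i j => a * u i j + b * v i j)
    = a * inner_h N h w u + b * inner_h N h w v.
Proof.
rewrite !inner_hE mulrCA [b * _]mulrCA -mulrDr -grid_sum_linear.
by congr (_ * _); apply: eq_grid_sum => i j; ring.
Qed.

Lemma inner_h_opp u v : inner_h N h (grid_opp u) v = - inner_h N h u v.
Proof.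
rewrite !inner_hE -mulrN; congr (_ * _); rewrite -mulN1r.
rewrite -[RHS]addr0 -[X in _ = _ + X](mul0r (grid_sum N u)) -grid_sum_linear.
by apply: eq_grid_sum => i j; rewrite /grid_opp; ring.
Qed.

Lemma inner_h_net_charge u p n rhof :
  inner_h N h u (net_charge p n rhof)
    = inner_h N h u p - inner_h N h u n + inner_h N h u rhof.
Proof.
have -> : net_charge p n rhof
    = (fun i j => 1 * (1 * p i j + -1 * n i j) + 1 * rhof i j).
  by apply/funext => i; apply/funext => j; rewrite /net_charge; ring.
by rewrite (inner_h_linear _ _ (fun i j => 1 * p i j + _)) inner_h_linear; ring.
Qed.

Lemma grad_inner_hC u v : grad_inner_h N h u v = grad_inner_h N h v u.
Proof.
congr (_ * _); apply: eq_bigr => i _; apply: eq_bigr => j _; ring.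
Qed.

(** The Poisson equation tested against an arbitrary periodic u; the theorem takes for u the
    potential of the intermediate level. *)
Lemma grad_inner_h_poisson u f phi : is_poisson_inv N h eps f phi ->
  grid_periodic N u -> eps ^+ 2 * grad_inner_h N h u phi = inner_h N h u f.
Proof.
move=> [pphi <- _] pu; rewrite grad_inner_h_by_parts//.
have -> : (fun i j => - eps ^+ 2 * laplacian_h h phi i j)
    = (fun i j => - eps ^+ 2 * laplacian_h h phi i j + 0 * u i j).
  by apply/funext => i; apply/funext => j; ring.
by rewrite inner_h_linear; ring.
Qed.

End Energy.

(** * The scheme: invariants of the iterates and energy decay *)

Lemma ETD2_periodic_ge0 (R : realType) (N : nat) (h eps tau : R)
    (rhof p0 n0 : grid R) (p n phi : nat -> grid R) :
  0 < h -> 0 < tau -> (0 < N)%N ->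
  grid_periodic N p0 -> grid_periodic N n0 ->
  (forall i j, 0 <= p0 i j) -> (forall i j, 0 <= n0 i j) ->
  ETD2_solution N h eps tau rhof p0 n0 p n phi ->
  forall k, [/\ grid_periodic N (p k), grid_periodic N (n k),
    (forall i j, 0 <= p k i j) & (forall i j, 0 <= n k i j)].
Proof.
move=> h0 tau0 N0 pp0 pn0 p0_ge0 n0_ge0 [Ep0 En0 Ephi Ep1 En1 EpS EnS].
have tau20 : 0 < 2%:R * tau by rewrite mulr_gt0.
have phi_per k : grid_periodic N (phi k) by have [] := Ephi k.
have phiN_per k := grid_periodic_opp (phi_per k).
pose good k := [/\ grid_periodic N (p k), grid_periodic N (n k),
    (forall i j, 0 <= p k i j) & (forall i j, 0 <= n k i j)].
have good0 : good 0%N by rewrite /good Ep0 En0.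
(* The recursion reaches back two levels, so the induction carries two consecutive ones. *)
suff H k : good k /\ good k.+1 by move=> k; have [] := H k.
elim: k => [|k [goodk goodSk]]; split=> //.
  case: good0 => gp gn gp0 gn0; rewrite /good Ep1 En1; split.
  - exact: op_exp_L_h_periodic.
  - exact: op_exp_L_h_periodic.
  - exact: (op_exp_L_h_ge0 _ h0 tau0 N0 gp gp0).
  - exact: (op_exp_L_h_ge0 _ h0 tau0 N0 gn gn0).
case: goodk => gp gn gp0 gn0; rewrite /good EpS// EnS//=; split.
- exact: op_exp_L_h_periodic.
- exact: op_exp_L_h_periodic.
- exact: (op_exp_L_h_ge0 _ h0 tau20 N0 gp gp0).
- exact: (op_exp_L_h_ge0 _ h0 tau20 N0 gn gn0).
Qed.

Theorem theorem6 (R : realType) (L : R) (N : nat) (eps tau : R)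
  (p0 n0 rhof : grid R) (p n phi : nat -> grid R)
  (hL : 0 < L) (hN : (0 < N)%N) (heps : 0 < eps) (htau : 0 < tau)
  (hp0 : grid_periodic N p0) (hn0 : grid_periodic N n0) (hrhof : grid_periodic N rhof)
  (hmean : inner_h N (L / N%:R) (net_charge p0 n0 rhof) (grid_one R) = 0)
  (hsol : ETD2_solution N (L / N%:R) eps tau rhof p0 n0 p n phi)
  (hp0_ge0 : forall i j : int, 0 <= p0 i j)
  (hn0_ge0 : forall i j : int, 0 <= n0 i j) :
  forall k : nat, (1 <= k)%N ->
    modified_energy N (L / N%:R) eps p n phi k.+1
      <= modified_energy N (L / N%:R) eps p n phi k.
Proof.
case=> [//|k] _; move: hsol; set h := L / N%:R => sol.
have h0 : 0 < h by rewrite divr_gt0// ltr0n.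
have [gp gn gp0 gn0] := ETD2_periodic_ge0 h0 htau hN hp0 hn0 hp0_ge0 hn0_ge0 sol k.
case: sol => _ _ Ephi _ _ EpS EnS.
have [phi_per _ _] := Ephi k.+1.
have tau2 : 0 < 2%:R * tau by rewrite mulr_gt0.
have := relative_entropy_op_exp_L_h h0 tau2 hN (grid_periodic_opp phi_per) gp gp0.
have := relative_entropy_op_exp_L_h h0 tau2 hN phi_per gn gn0.
(* Writing k as the predecessor of k+1 lets the two-level recursion match syntactically. *)
rewrite -[p k]/(p k.+1.-1) -[n k]/(n k.+1.-1) -EpS// -EnS// !inner_h_opp /=.
rewrite /modified_energy /= => Hn Hp.
(* The entropies of level k+1 cancel. Testing the Poisson equations of levels k+2 and k with the
   potential of level k+1 turns the gradient terms into pairings with the densities, and the fixed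
   charge [rhof] drops out of their difference. *)
have := grad_inner_h_poisson (Ephi k.+2) phi_per.
have := grad_inner_h_poisson (Ephi k) phi_per.
rewrite !inner_h_net_charge (grad_inner_hC _ _ (phi k.+2)).
by move=> Gk GSSk; lra.
Qed.
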